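(* Let $X$ be a compact metric space with Borel $\sigma$-algebra $\mathcal{B}$, let $T:X\to X$ be a homeomorphism, and let $\mu$ be a Borel probability measure on $X$ that is ergodic with respect to $T$. Consider the statements: (1) $(X,T)$ is uniquely ergodic. (2) For every sequence $(F_k)_{k=1}^\infty$ of Borel sets of positive $\mu$-measure and every $f\in C(X)$, the limit $\lim_{k\to\infty}\alpha_{F_k}\left(\frac1k\sum_{i=0}^{k-1}T^i f\right)$ exists and equals $\int f\,\mathrm{d}\mu$. (3) For every sequence $(U_k)_{k=1}^\infty$ of open sets of positive $\mu$-measure and every $f\in C(X)$, the limit $\lim_{k\to\infty}\alpha_{U_k}\left(\frac1k\sum_{i=0}^{k-1}T^i f\right)$ exists and equals $\int f\,\mathrm{d}\mu$. Then (1)$\Rightarrow$(2)$\Rightarrow$(3). Further, if $\mu$ is strictly positive, then (3)$\Rightarrow$(1).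
   Context: Ergodic includes that $\mu$ is $T$-invariant. $T^i f$ denotes $f\circ T^i$. $C(X)$ is the space of complex-valued continuous functions on $X$. For $F\in\mathcal{B}$ with $\mu(F)>0$, $\alpha_F(f)=\frac1{\mu(F)}\int_F f\,\mathrm{d}\mu$. $(X,T)$ is uniquely ergodic if there is exactly one $T$-invariant Borel probability measure on $X$. $\mu$ is strictly positive if $\mu(U)>0$ for every nonempty open $U\subseteq X$. *)

(* Defs.v *)
From HB Require Import structures.
From mathcomp Require Import all_boot all_order all_algebra.
From mathcomp Require Import all_classical all_reals all_analysis.
From mathcomp Require Import complex.

Set Implicit Arguments.
Unset Strict Implicit.
Unset Printing Implicit Defensive.
Import Order.TTheory GRing.Theory Num.Theory.
Import numFieldNormedType.Exports.

Local Open Scope classical_set_scope.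
Local Open Scope ring_scope.
Local Open Scope complex_scope.

(* A [measurableType] carries a base point, hence so must the metric space. This
   only excludes the empty space, which has no probability measure. *)
#[short(type="pmetricType")]
HB.structure Definition PointedMetric (K : numDomainType) :=
  {M of Metric K M & Pointed M}.

(* The topology of the modulus, as for every [numFieldType]. *)
HB.instance Definition _ (R : realType) := PseudoPointedMetric.copy R[i] R[i]^o.

Definition borel {R : realType} (X : pmetricType R) : Type :=
  g_sigma_algebraType (@open X).

Definition homeomorphism {X Y : topologicalType} (f : X -> Y) : Prop :=
  continuous f /\
  exists g : Y -> X, [/\ continuous g, cancel f g & cancel g f].

Section dynamics.
Context {R : realType} {X : pmetricType R}.
Implicit Types (T : X -> X) (mu nu : probability (borel X) R) (f : X -> R[i]).

Definition invariant_measure T mu : Prop :=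
  forall A : set (borel X), measurable A -> mu (T @^-1` A) = mu A.

Definition ergodic T mu : Prop :=
  invariant_measure T mu /\
  forall A : set (borel X), measurable A -> T @^-1` A = A ->
    mu A = 0%E \/ mu A = 1%E.

(* Measures are total functions on [set X], constrained on measurable sets only,
   so two of them are identified when they agree on the Borel sets. *)
Definition uniquely_ergodic T : Prop :=
  exists mu, invariant_measure T mu /\
    forall nu, invariant_measure T nu ->
      forall A : set (borel X), measurable A -> nu A = mu A.

Definition strictly_positive mu : Prop :=
  forall U : set X, open U -> U !=set0 -> (0 < mu U)%E.

Definition Cintegral mu (D : set (borel X)) f : R[i] :=
  (\int[mu]_(x in D) complex.Re (f x)) +i* (\int[mu]_(x in D) complex.Im (f x)).

Definition mean mu (F : set (borel X)) f : R[i] :=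
  ((fine (mu F))^-1)%:C * Cintegral mu F f.

Definition ergodic_average T f (k : nat) : X -> R[i] :=
  fun x => k%:R^-1 * \sum_(i < k) f (iter i T x).

End dynamics.

(* Main.v *)
Require Import Defs.
From HB Require Import structures.
From mathcomp Require Import all_boot all_order all_algebra.
From mathcomp Require Import all_classical all_reals all_analysis.
From mathcomp Require Import complex ring lra.
Set Implicit Arguments.
Unset Strict Implicit.
Unset Printing Implicit Defensive.
Import Order.TTheory GRing.Theory Num.Theory.
Import numFieldNormedType.Exports.
Local Open Scope classical_set_scope.
Local Open Scope ring_scope.

(* (1) => (2). Along an ultrafilter, the means of the ergodic averages converge to
   a positive normalized functional on C(X), which is T-invariant because the
   averages of f o T and f differ by O(1/k). By Riesz representation it is
   integration against a T-invariant probability measure, hence against mu.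
   (3) => (1). Taking for U_k a neighbourhood of x on which the k-th average of f
   varies by less than 1/(k+1), the averages converge pointwise to the integral
   of f; integrating against any invariant measure nu, by dominated convergence,
   gives the same integral of f for nu and mu. *)

(** * Borel sets and continuous functions on a metric space *)

Section metric.
Context {R : realType} {X : pmetricType R}.

(** The function is the distance to the complement of [C]: it is 1-Lipschitz, vanishes off [C], and
    is positive on [C] because each point of [C] has a ball inside [C]. *)
Lemma open_cozero (C : set X) : open C ->
  exists phi : X -> R, [/\ continuous phi, forall x, 0 <= phi x &
    C = [set x | 0 < phi x]].
Proof.
(* The infimum of the empty set is 0 by convention, so the whole space is treated apart, with the
   constant 1. *)
move=> oC; have [CT|/existsNP[a Ca]] := pselect (forall x, C x).
  exists (cst 1); split => [x|x|]; rewrite ?ler01//; first exact: cvg_cst.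
  by apply/seteqP; split => // x _ /=; rewrite ltr01.
pose D x := [set mdist x y | y in ~` C].
have D0 x : D x !=set0 by exists (mdist x a), a.
have lbD x : has_lbound (D x) by exists 0 => _ [y _ <-]; exact: mdist_ge0.
have lip x y : inf (D x) <= mdist x y + inf (D y).
  rewrite -lerBlDl; apply: lb_le_inf => // _ [z Cz <-].
  rewrite lerBlDl; apply: le_trans (metric_triangle x y z).
  by apply: inf_lbound => //; exists z.
exists (fun x => inf (D x)); split.
- move=> x; apply/cvgrPdist_lt => e e0; near=> y.
  have xy : mdist x y < e.
    have : ball x e y by near: y; exact: nbhsx_ballx.
    by rewrite ballEmdist.
  apply: le_lt_trans xy; have := lip x y; have := lip y x.
  by rewrite (metric_sym y x) ler_norml; lra.
- by move=> x; apply: lb_le_inf => // _ [y _ <-]; exact: mdist_ge0.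
- apply/seteqP; split => x /=.
    move=> Cx; have /nbhs_ballP[e /= e0 xeC] := open_nbhs_nbhs (conj oC Cx).
    apply: lt_le_trans e0 _; apply: lb_le_inf => // _ [y Cy <-].
    by rewrite leNgt; apply/negP => xye; apply/Cy/xeC; rewrite ballEmdist.
  apply: contraPP => Cx; apply/negP; rewrite -leNgt.
  by apply: inf_lbound => //; exists x => //; exact: mdistxx.
Unshelve. all: by end_near. Qed.

Lemma open_measurable_borel (U : set X) : open U -> measurable (U : set (borel X)).
Proof. exact: sub_sigma_algebra. Qed.

Lemma continuous_measurable_borel (f : X -> R) : continuous f ->
  measurable_fun [set: borel X] (f : borel X -> R).
Proof.
move=> /continuousP cf; apply: (measurability _ (measurable_realfun.RGenOpens.measurableE R)).
move=> _ [_ [a [b ->] <-]]; rewrite setTI; apply: open_measurable_borel.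
exact/cf/interval_open.
Qed.

Lemma continuous_borel_measurable (T : X -> X) : continuous T ->
  measurable_fun [set: borel X] (T : borel X -> borel X).
Proof.
move=> /continuousP cT; apply: (@measurability _ _ (borel X) (borel X) _ T (@open X)) => //.
by move=> _ [U oU <-]; rewrite setTI; apply: open_measurable_borel; exact: cT.
Qed.

Section compact.
Hypothesis X_compact : compact [set: X].

Lemma continuous_compact_bounded (f : X -> R) : continuous f ->
  exists2 M, 0 <= M & forall x, `|f x| <= M.
Proof.
move=> cf; have cn : {within [set: X], continuous (fun x => `|f x|)}.
  apply: continuous_subspaceT => x; apply: continuous_comp (cf x) _.
  exact: norm_continuous.
have [|c _ fc] := compact_EVT_max _ X_compact cn; first by exists point.
by exists `|f c| => // x; apply: fc; rewrite inE.
Qed.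

Lemma continuous_integrable (mu : {finite_measure set (borel X) -> \bar R}) (A : set (borel X))
  (f : X -> R) : measurable A -> continuous f -> mu.-integrable A (EFin \o f).
Proof.
move=> mA cf; have [M M0 fM] := continuous_compact_bounded cf.
apply: (@measurable_bounded_integrable _ (borel X)) => //.
- by rewrite -ge0_fin_numE ?fin_num_measure.
- apply: measurable_funS (continuous_measurable_borel cf) => //.
- by exists M; split; [exact: ger0_real|move=> N MN x _; exact: le_trans (ltW MN)].
Qed.
End compact.
End metric.

(** * Riesz representation on a compact metric space *)

(** [L] is total, but its laws are required on continuous functions only. Integrals and limits along
    an ultrafilter thus qualify, whatever their values elsewhere. *)
Record positive_functional {R : realType} {X : topologicalType} (L : (X -> R) -> R) : Prop :=
  PositiveFunctional {
    functionalD : forall f g : X -> R, continuous f -> continuous g ->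
      L (fun x => f x + g x) = L f + L g ;
    functionalZ : forall (c : R) (f : X -> R), continuous f -> L (fun x => c * f x) = c * L f ;
    functional_ge0 : forall f : X -> R, continuous f -> (forall x, 0 <= f x) -> 0 <= L f ;
    functional1 : L (fun=> 1) = 1 }.

Lemma continuous_sum_ord {R : realType} {X : topologicalType} (g : nat -> X -> R) n :
  (forall i, continuous (g i)) -> continuous (fun x => \sum_(i < n) g i x).
Proof.
move=> cg; elim: n => [|n IHn].
  by under eq_fun do rewrite big_ord0; move=> x; exact: cvg_cst.
under eq_fun do rewrite big_ord_recr/=.
by move=> x; exact: cvgD (IHn x) (cg n x).
Qed.

(** * Positive functionals and covers by increasing sequences of functions *)

Section positive_functional_theory.
Context {R : realType} {X : topologicalType} {L : (X -> R) -> R}.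
Hypothesis pL : positive_functional L.

Lemma le_functional (f g : X -> R) : continuous f -> continuous g ->
  (forall x, f x <= g x) -> L f <= L g.
Proof.
move=> cf cg fg; have cgf : continuous (fun x => g x - f x).
  by move=> x; exact: cvgB (cg x) (cf x).
have -> : g = (fun x => f x + (g x - f x)) by apply/funext => x; rewrite subrKC.
by rewrite functionalD// lerDl functional_ge0// => x; rewrite subr_ge0.
Qed.

Lemma functional0 : L (fun=> 0) = 0.
Proof.
have -> : (fun=> 0) = (fun x : X => 0 * 1) :> (X -> R).
  by apply/funext => x; rewrite mul0r.
by rewrite functionalZ ?mul0r// => x; exact: cvg_cst.
Qed.

Lemma functional_sum (g : nat -> X -> R) n : (forall i, continuous (g i)) ->
  L (fun x => \sum_(i < n) g i x) = \sum_(i < n) L (g i).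
Proof.
move=> cg; elim: n => [|n IHn].
  under [fun x => _]eq_fun do rewrite big_ord0.
  by rewrite big_ord0 functional0.
under [fun x => _]eq_fun do rewrite big_ord_recr/=.
by rewrite big_ord_recr/= functionalD// ?IHn//; exact: continuous_sum_ord.
Qed.

Lemma functional_norm_le (f : X -> R) M : continuous f ->
  (forall x, `|f x| <= M) -> `|L f| <= M.
Proof.
move=> cf fM; have c1 : continuous ((fun=> 1) : X -> R) by move=> x; exact: cvg_cst.
have cM c : continuous ((fun=> c * 1) : X -> R) by move=> x; exact: cvg_cst.
have LM c : L (fun=> c * 1) = c by rewrite functionalZ// functional1// mulr1.
rewrite ler_norml -[X in X <= _ <= _]LM -[X in _ <= _ <= X]LM.
by apply/andP; split; apply: le_functional => // x;
  have := fM x; rewrite ler_norml mulr1 => /andP[].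
Qed.

(* Outer regularity with respect to functions: [A] lies in the set where the
   supremum of an increasing sequence of functions is at least 1. *)
Definition covers (A : set X) (c : R) : Prop :=
  exists g : nat -> X -> R,
    [/\ forall n, continuous (g n), forall n x, 0 <= g n x,
        forall x, nondecreasing_seq (g^~ x), forall n, L (g n) <= c
      & forall x, A x -> forall r, r < 1 -> exists n, r < g n x].

Lemma covers_ge0 A c : covers A c -> 0 <= c.
Proof. by move=> [g [cg g0 _ Lg _]]; apply: le_trans (Lg 0%N); exact: functional_ge0. Qed.

Lemma covers_function A (h : X -> R) : continuous h -> (forall x, 0 <= h x) ->
  (forall x, A x -> 1 <= h x) -> covers A (L h).
Proof.
move=> ch h0 h1; exists (fun=> h); split => // [x m n //|x Ax r r1]; exists 0%N.
exact: lt_le_trans r1 (h1 _ Ax).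
Qed.

Lemma covers1 A : covers A 1.
Proof.
by rewrite -(functional1 pL); apply: covers_function => // x; exact: cvg_cst.
Qed.

Lemma subset_covers A B c : A `<=` B -> covers B c -> covers A c.
Proof.
by move=> AB [g [cg g0 ndg Lg g1]]; exists g; split => // x /AB; exact: g1.
Qed.

(* The cover of the union is the diagonal [n |-> g 0 n + ... + g n n]. *)
Lemma covers_bigcup (F : nat -> set X) (c : nat -> R) (s : R) :
  (forall i, covers (F i) (c i)) -> (forall n, \sum_(i < n) c i <= s) ->
  covers (\bigcup_i F i) s.
Proof.
move=> /choice[g Fg] cs; exists (fun n x => \sum_(i < n.+1) g i n x).
have cg i n : continuous (g i n) by case: (Fg i).
have g0 i n x : 0 <= g i n x by case: (Fg i).
have ndg i x : nondecreasing_seq ((g i)^~ x) by case: (Fg i).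
split.
- by move=> n; apply: (continuous_sum_ord (g := g^~ n)).
- by move=> n x; rewrite sumr_ge0.
- move=> x; apply/nondecreasing_seqP => n.
  rewrite [leRHS]big_ord_recr/= -[leLHS]addr0 lerD// ler_sum// => i _.
  exact: ndg.
- move=> n; rewrite (functional_sum (g := g^~ n))//.
  apply: le_trans (cs n.+1); apply: ler_sum => i _.
  by case: (Fg i).
- move=> x [i _ Fix] r r1; have [_ _ _ _ /(_ x Fix r r1)[n rn]] := Fg i.
  exists (maxn i n); apply: (lt_le_trans rn).
  have im : (i < (maxn i n).+1)%N by rewrite ltnS leq_maxl.
  rewrite (bigD1 (Ordinal im))//= -[leLHS]addr0 lerD ?sumr_ge0//.
  by apply: ndg; exact: leq_maxr.
Qed.

(* [g n * min 1 (n phi)] covers the part of [A] in the cozero set of [phi], and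
   [g n * (1 - min 1 (m phi))] the rest, for any fixed [m]. *)
Lemma covers_cozero A c (phi : X -> R) e : continuous phi -> (forall x, 0 <= phi x) ->
  0 < e -> covers A c ->
  exists a b, [/\ covers (A `&` [set x | 0 < phi x]) a,
    covers (A `&` ~` [set x | 0 < phi x]) b & a + b <= c + e].
Proof.
move=> cphi phi0 e0 [g [cg g0 ndg Lg g1]].
pose p n x := Num.min 1 (n%:R * phi x).
have cp n : continuous (p n).
  move=> x; apply: (@continuous_min _ _ (fun=> 1) (fun x => n%:R * phi x)).
    exact: cvg_cst.
  by apply: cvgM; [exact: cvg_cst|exact: cphi].
have p0 n x : 0 <= p n x by rewrite le_min ler01 mulr_ge0.
have p1 n x : p n x <= 1 by rewrite ge_min lexx.
have ndp x : nondecreasing_seq (p^~ x).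
  move=> m n mn; rewrite /p le_min !ge_min lexx/=; apply/orP; right.
  by rewrite ler_wpM2r// ler_nat.
pose u m n := L (fun x => g n x * p m x).
have cgp m n : continuous (fun x => g n x * p m x).
  by move=> x; exact: cvgM (cg n x) (cp m x).
have u_nd m n m' n' : (m <= m')%N -> (n <= n')%N -> u m n <= u m' n'.
  move=> mm nn; apply: le_functional => // x.
  by apply: ler_pM => //; [exact: ndg|exact: ndp].
pose U := [set u n n | n in setT].
have U0 : U !=set0 by exists (u 0%N 0%N), 0%N.
have ubU : has_ubound U.
  exists c => _ [n _ <-]; apply: le_trans (Lg n); apply: le_functional => // x.
  by rewrite -[leRHS]mulr1 ler_wpM2l.
have uU n : u n n <= sup U by apply: ub_le_sup => //; exists n.
(* [sup U] is the limit of [L (g n * p n)]. The index [m] at which it is reached up to [e] is the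
   one fixed in the second cover. *)
have [_ [m _ <-] um] := sup_adherent e0 (conj U0 ubU).
exists (sup U), (c - (sup U - e)); split; last by lra.
- exists (fun n x => g n x * p n x); split => //.
  + by move=> n x; rewrite mulr_ge0.
  + by move=> x n n' nn'; apply: ler_pM => //; [exact: ndg|exact: ndp].
  + move=> x [Ax /= phix] r r1.
    have [n rn] := g1 x Ax r r1.
    (* Beyond the second index [k * phi x >= 1], so the factor [p k x] is exactly 1. *)
    exists (maxn n (Num.Def.trunc (phi x)^-1).+1).
    set k := maxn _ _; have -> : p k x = 1.
      apply/min_idPl; rewrite -ler_pdivrMr// mul1r.
      apply: (@le_trans _ _ (Num.Def.trunc (phi x)^-1).+1%:R).
        by apply/ltW; exact: truncnS_gt.
      by rewrite ler_nat leq_maxr.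
    by rewrite mulr1; apply: lt_le_trans rn _; apply: ndg; exact: leq_maxl.
- exists (fun n x => g n x * (1 - p m x)).
  have cgq n : continuous (fun x => g n x * (1 - p m x)).
    move=> x; apply: cvgM; first exact: cg.
    by apply: cvgB; [exact: cvg_cst|exact: cp].
  have ndq x : nondecreasing_seq (fun n => g n x * (1 - p m x)).
    by move=> n n' nn'; apply: ler_wpM2r; [rewrite subr_ge0|exact: ndg].
  split => //.
  + by move=> n x; rewrite mulr_ge0// subr_ge0.
  (* Raising the index to [k >= m] gives [u m k >= u m m > sup U - e], which is subtracted from
     [L (g k) <= c]. *)
  + move=> n; set k := maxn m n.
    apply: (@le_trans _ _ (L (fun x => g k x * (1 - p m x)))).
      by apply: le_functional => // x; apply: ndq; exact: leq_maxr.
    suff : L (fun x => g k x * (1 - p m x)) + u m k = L (g k).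
      have := Lg k; have := u_nd m m m k (leqnn m) (leq_maxl m n); lra.
    rewrite -functionalD//; congr L; apply/funext => x; ring.
  + move=> x [Ax /= phix] r r1; have [n rn] := g1 x Ax r r1; exists n.
    have phi0x : phi x = 0 by apply/eqP; rewrite eq_le phi0 andbT leNgt; apply/negP.
    by rewrite /p phi0x mulr0 (min_idPr ler01) subr0 mulr1.
Qed.

(** A Dini argument: the sets where [g n] exceeds [1 - e] are open, increase with [n] and cover the
    space, so by compactness a single [n] works everywhere, and then [1 - e <= L (g n) <= c]. *)
Lemma covers_setT c : compact [set: X] -> X -> covers setT c -> 1 <= c.
Proof.
move=> Xc x0 [g [cg g0 ndg Lg g1]]; apply/ler_addgt0Pr => e e0.
have [n ng] : exists n, forall x, 1 - e < g n x.
  have : \forall n \near \oo, [set: X] `<=` (fun x => 1 - e < g n x).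
    apply: (compact_near_coveringP [set: X]).1 => // x _.
    have [n ngx] : exists n, 1 - e < g n x by apply: g1 => //; lra.
    exists ([set y | 1 - e < g n y], [set k | (n <= k)%N]) => /=.
      split; last by exists n.
      have ngx' : nbhs (g n x) [set z | 1 - e < z].
        by apply: open_nbhs_nbhs; split => //; exact: open_gt.
      exact: (cg n x _ ngx').
    move=> [y k] /= [nyg nk]; apply: lt_le_trans nyg _; exact: ndg.
  by move=> [n _ /(_ n (leqnn n)) ng]; exists n => x; exact: ng.
rewrite -lerBlDr; apply: le_trans (Lg n).
have c1 : continuous ((fun=> 1) : X -> R) by move=> x; exact: cvg_cst.
rewrite -[leLHS]mulr1 -[X in _ * X](functional1 pL) -(functionalZ pL)//.
apply: le_functional => // [x|x]; last by rewrite mulr1 ltW.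
by apply: cvgM; exact: cvg_cst.
Qed.

End positive_functional_theory.

(** * The outer measure of a positive functional *)

Section riesz_outer_measure.
Context {R : realType} {X : topologicalType} {L : (X -> R) -> R}.
Variable pL : positive_functional L.

(* [pL] is an argument so that the instances below can be attached to it. *)
Definition riesz_outer of positive_functional L := fun A : set X =>
  (inf [set c | covers (L := L) A c])%:E.
Local Notation rmu := (riesz_outer pL).

Lemma covers_has_inf (A : set X) : has_inf [set c | covers (L := L) A c].
Proof.
by split; [exists 1; exact: covers1|exists 0 => c /(covers_ge0 pL)].
Qed.

Lemma riesz_outer_le A c : covers (L := L) A c -> (rmu A <= c%:E)%E.
Proof. by move=> Ac; rewrite lee_fin; apply: ge_inf => //; exact: (covers_has_inf A).2. Qed.

Lemma riesz_outer_covers A (e : R) : 0 < e ->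
  covers (L := L) A (fine (rmu A) + e).
Proof.
move=> e0; have [c [g [cg g0 ndg Lg g1]] ce] := inf_adherent e0 (covers_has_inf A).
by exists g; split => // n; apply: le_trans (ltW ce).
Qed.

Lemma riesz_outer_ge0 A : (0 <= rmu A)%E.
Proof.
by rewrite lee_fin; apply: lb_le_inf => [|c /(covers_ge0 pL)//]; case: (covers_has_inf A).
Qed.

Lemma riesz_outer0 : rmu set0 = 0%E.
Proof.
apply/eqP; rewrite eq_le riesz_outer_ge0 andbT; apply: riesz_outer_le.
exists (fun _ _ => 0); split => // [n x|x m n //|n]; first exact: cvg_cst.
by rewrite (functional0 pL).
Qed.

Lemma le_riesz_outer : {homo rmu : A B / A `<=` B >-> (A <= B)%E}.
Proof.
move=> A B AB; apply/lee_addgt0Pr => e e0.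
rewrite -[rmu B]fineK// -EFinD; apply: riesz_outer_le.
exact/(subset_covers AB)/riesz_outer_covers.
Qed.

Lemma riesz_outer_sigma_subadditive : sigma_subadditive rmu.
Proof.
move=> F; set S := (X in (_ <= X)%E).
have S0 : (0 <= S)%E by apply: nneseries_ge0 => *; exact: riesz_outer_ge0.
have [Soo|] := eqVneq S +oo%E; first by rewrite Soo leey.
rewrite -ltey -ge0_fin_numE// => Sfin.
apply/lee_addgt0Pr => e e0; rewrite -(fineK Sfin) -EFinD; apply: riesz_outer_le.
(* The errors form a geometric series with partial sums [e - e / 2 ^+ n], below [e]. *)
apply: (covers_bigcup pL (c := fun i => fine (rmu (F i)) + e / 2 ^+ i.+1)).
  by move=> i; apply: riesz_outer_covers; rewrite divr_gt0// exprn_gt0.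
move=> n; rewrite big_split/= lerD//.
  have : (\sum_(0 <= i < n) rmu (F i) <= S)%E.
    by apply: nneseries_lim_ge => *; exact: riesz_outer_ge0.
  by rewrite -lee_fin (fineK Sfin) -sumEFin big_mkord.
suff -> : \sum_(i < n) e / 2 ^+ i.+1 = e - e / 2 ^+ n.
  by rewrite gerBl divr_ge0// ?ltW// exprn_gt0.
elim: n => [|n IHn]; first by rewrite big_ord0 expr0 divr1 subrr.
by rewrite big_ord_recr/= IHn exprS; field.
Qed.

HB.instance Definition _ := isOuterMeasure.Build R X rmu riesz_outer0
  riesz_outer_ge0 le_riesz_outer riesz_outer_sigma_subadditive.

End riesz_outer_measure.

(** * The measure on the Borel sets *)

Section riesz_measure.
Context {R : realType} {X : pmetricType R} {L : (X -> R) -> R}.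
Variable pL : positive_functional L.

Definition riesz_measure : set (borel X) -> \bar R := riesz_outer pL.

(** Caratheodory measurable sets form a sigma-algebra, so open sets suffice. An open set is a cozero
    set, along which any cover splits at arbitrarily small cost. *)
Lemma riesz_caratheodory (A : set (borel X)) : measurable A ->
  (riesz_outer pL).-caratheodory A.
Proof.
rewrite /measurable/=; apply: smallest_sub => [|U oU].
  split; first exact: caratheodory_measurable_set0.
    by move=> B mB; rewrite setTD; exact: caratheodory_measurable_setC.
  exact: caratheodory_measurable_bigcup.
have [phi [cphi phi0 ->]] := open_cozero oU.
apply: le_caratheodory_measurable => B; apply/lee_addgt0Pr => e e0.
(* One half of [e] pays for a nearly optimal cover of [B], the other for splitting it. *)
have e20 : 0 < e / 2 by rewrite divr_gt0.
have := covers_cozero pL cphi phi0 e20 (riesz_outer_covers pL B e20).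
move=> [a [b [Ba Bb ab]]]; apply: (@le_trans _ _ (a%:E + b%:E)%E).
  by apply: leeD; exact: riesz_outer_le.
rewrite -[X in (_ <= X + _)%E]fineK// -!EFinD lee_fin; apply: le_trans ab _; lra.
Qed.

Let riesz_measure_sigma_additive : semi_sigma_additive riesz_measure.
Proof.
move=> F mF tF mUF; apply: caratheodory_measure_sigma_additive => //.
- by move=> i; exact: riesz_caratheodory.
- exact: riesz_caratheodory.
Qed.

HB.instance Definition _ := isMeasure.Build _ _ _ riesz_measure
  (riesz_outer0 pL) (riesz_outer_ge0 pL) riesz_measure_sigma_additive.

End riesz_measure.

(** * The representation theorem *)

Section riesz.
Context {R : realType} {X : pmetricType R}.
Hypothesis X_compact : compact [set: X].
Implicit Types mu nu : probability (borel X) R.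

Lemma positive_functional_mean mu (F : set (borel X)) :
  measurable F -> (0 < mu F)%E ->
  positive_functional (fun f : X -> R => (fine (mu F))^-1 * \int[mu]_(x in F) f x).
Proof.
move=> mF F0; have F0' : 0 < fine (mu F).
  by rewrite fine_gt0// F0 -ge0_fin_numE ?fin_num_measure.
have iF (f : X -> R) : continuous f -> mu.-integrable F (EFin \o f).
  exact: continuous_integrable.
split => [f g cf cg|c f cf|f cf f0|].
- by rewrite (@RintegralD _ (borel X))//; [rewrite mulrDr|exact: iF|exact: iF].
- by rewrite (@RintegralZl _ (borel X))//; [rewrite mulrCA|exact: iF].
- by apply: mulr_ge0; [rewrite invr_ge0 ltW|exact: Rintegral_ge0].
- by rewrite (@Rintegral_cst _ (borel X))// mul1r mulVf// gt_eqF.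
Qed.

Lemma positive_functional_Rintegral nu :
  positive_functional (fun f : X -> R => \int[nu]_(x in [set: borel X]) f x).
Proof.
have := positive_functional_mean (mu := nu) measurableT.
rewrite probability_setT invr1; under eq_fun do rewrite mul1r.
by apply; rewrite lte01.
Qed.

Section representation.
Variable L : (X -> R) -> R.
Hypothesis pL : positive_functional L.

Lemma riesz_measure_setT : riesz_measure pL setT = 1%E.
Proof.
apply/eqP; rewrite eq_le (riesz_outer_le pL (covers1 pL _))/=.
rewrite lee_fin; apply: lb_le_inf => [|c]; first by exists 1; exact: covers1.
exact: (covers_setT pL X_compact point).
Qed.

(** With [I] the integral against the Riesz measure, [I f <= L f] for all continuous [f] is enough,
    since [- f] gives the reverse inequality. This is proved first with [(f - 1)^+] in place of [f]
    on the left, then for [f >= 0] by scaling, then in general by adding a constant. *)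
Lemma riesz_representation : exists nu : probability (borel X) R,
  forall f : X -> R, continuous f -> \int[nu]_(x in [set: borel X]) f x = L f.
Proof.
have [nu nuE] : exists nu : probability (borel X) R, nu = riesz_measure pL :> (set _ -> _).
  pose p := Measure_isProbability.Build _ _ _ (riesz_measure pL) riesz_measure_setT.
  pose nu : probability (borel X) R := HB.pack (riesz_measure pL) p.
  by exists nu.
have pI := positive_functional_Rintegral nu.
set I := fun f : X -> R => \int[nu]_(x in [set: borel X]) f x in pI.
have cc c : continuous ((fun=> c) : X -> R) by move=> x; exact: cvg_cst.
have cM (f : X -> R) c : continuous f -> continuous (fun x => c * f x).
  by move=> cf x; exact: cvgM (cc c x) (cf x).
have cB (f : X -> R) c : continuous f -> continuous (fun x => Num.max (f x - c) 0).
  move=> cf x; apply: (@continuous_max _ _ (fun x => f x - c) (fun=> 0)); last exact: cc.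
  exact: cvgB (cf x) (cc c x).
have cm (f : X -> R) : continuous f -> continuous (fun x => Num.min (f x) 1).
  by move=> cf x; apply: (@continuous_min _ _ f (fun=> 1)); [exact: cf|exact: cc].
(* With [g = (f - 1)^+], [min g 1 <= 1_{g > 0} <= min f 1]; the middle term has
   measure at most [L (min f 1)], and summing over the layers of [f] concludes. *)
have trunc n : forall f : X -> R, continuous f -> (forall x, 0 <= f x) ->
    (forall x, f x <= n%:R) -> I (fun x => Num.max (f x - 1) 0) <= L f.
  elim: n => [f cf f0 fn|n IHn f cf f0 fn].
    have -> : (fun x => Num.max (f x - 1) 0) = (fun=> 0).
      by apply/funext => x; apply/max_idPr; have := fn x; lra.
    by rewrite (functional0 pI) (functional_ge0 pL).
  set g := fun x => Num.max (f x - 1) 0.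
  have cg : continuous g by exact: cB.
  have g0 x : 0 <= g x by rewrite le_max lexx orbT.
  (* Removing one layer lowers the bound by 1, so the induction hypothesis applies to [g]. *)
  have gn x : g x <= n%:R.
    by rewrite ge_max ler0n andbT; have := fn x; rewrite -natr1; lra.
  have gE : g = (fun x => Num.min (g x) 1 + Num.max (g x - 1) 0).
    apply/funext => x; rewrite minElt maxElt.
    by case: ltP => ?; case: ltP => ?; lra.
  have fE : f = (fun x => Num.min (f x) 1 + g x).
    apply/funext => x; rewrite /g minElt maxElt.
    by case: ltP => ?; case: ltP => ?; lra.
  rewrite -/(I g) [in leLHS]gE (functionalD pI); [|exact: cm|exact: cB].
  rewrite [in leRHS]fE (functionalD pL)//; last exact: cm.
  apply: lerD; last exact: IHn.
  pose A : set (borel X) := [set x | 0 < g x].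
  have mA : measurable A.
    apply: open_measurable_borel.
    by move/continuousP : (cg) => /(_ _ (@open_gt _ 0)).
  have nuA : fine (nu A) <= L (fun x => Num.min (f x) 1).
    rewrite -lee_fin fineK ?fin_num_measure// nuE.
    apply/riesz_outer_le/covers_function => //; first exact: cm.
      by move=> x; rewrite le_min f0 ler01.
    move=> x; rewrite /A /= /g lt_max ltxx orbF => fx.
    by rewrite le_min lexx andbT; lra.
  apply: le_trans nuA.
  rewrite -[leRHS]mul1r -(@Rintegral_cst _ (borel X))//.
  have -> : I (fun x => Num.min (g x) 1) = \int[nu]_(x in A) Num.min (g x) 1.
    rewrite /I [RHS](@Rintegral_mkcond _ (borel X)); apply: eq_Rintegral => x _.
    rewrite patchE; case: ifPn => //; rewrite notin_setE => /negP; rewrite -leNgt => gx.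
    by rewrite (le_anti (introT andP (conj gx (g0 x)))) (min_idPl ler01).
  apply: (@le_Rintegral _ (borel X)) => //.
  - by apply: continuous_integrable => //; exact: cm.
  - exact: continuous_integrable.
  - by move=> x _; rewrite ge_min lexx orbT.
have le0 (f : X -> R) : continuous f -> (forall x, 0 <= f x) -> I f <= L f.
  move=> cf f0; apply/ler_addgt0Pr => e e0.
  (* Truncation loses at most 1 on [f / e], hence at most [e] on [f]. *)
  pose g x := e^-1 * f x.
  have cg : continuous g by exact: cM.
  have g0 x : 0 <= g x by rewrite mulr_ge0// invr_ge0 ltW.
  have [M M0 gM] := continuous_compact_bounded X_compact cg.
  have := trunc (Num.Def.trunc M).+1 g cg g0 _.
  have : I g <= I (fun x => Num.max (g x - 1) 0) + 1.
    rewrite -[X in _ <= _ + X](functional1 pI) -(functionalD pI)//; last exact: cB.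
    apply: le_functional => //.
      by move=> x; apply: cvgD; [exact: cB|exact: cc].
    by move=> x; rewrite -lerBlDr le_max lexx.
  rewrite (functionalZ pI)// (functionalZ pL)// => h1 h2.
  have {h1 h2} : e^-1 * I f <= e^-1 * L f + 1.
    apply: le_trans h1 _; rewrite lerD2r; apply: h2 => x.
    apply: le_trans (ltW (truncnS_gt M)); exact: le_trans (ler_norm _) (gM x).
  have -> : e^-1 * L f + 1 = e^-1 * (L f + e) by rewrite mulrDr mulVf// gt_eqF.
  by rewrite ler_pM2l// invr_gt0.
have le (f : X -> R) : continuous f -> I f <= L f.
  move=> cf; have [M M0 fM] := continuous_compact_bounded X_compact cf.
  have := le0 (fun x => f x + M * 1).
  rewrite (functionalD pI) ?(functionalD pL)//.
  rewrite (functionalZ pI) ?(functionalZ pL)// (functional1 pI) (functional1 pL).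
  rewrite lerD2r; apply; first by move=> x; exact: cvgD (cf x) (cc _ x).
  by move=> x; have := fM x; rewrite ler_norml; lra.
exists nu => f cf; apply/eqP; rewrite eq_le le//=.
have := le (fun x => -1 * f x); rewrite (functionalZ pI)// (functionalZ pL)//.
by rewrite !mulN1r lerN2; apply; exact: cM.
Qed.
End representation.
End riesz.

(** * Measures determined by integrals of continuous functions *)

Section determination.
Context {R : realType} {X : pmetricType R}.
Hypothesis X_compact : compact [set: X].
Implicit Types (mu nu : probability (borel X) R) (f : X -> R).

Lemma bounded_convergence_Rintegral mu (u : nat -> borel X -> R) (f : borel X -> R) M :
  (forall n, measurable_fun setT (u n)) -> measurable_fun setT f ->
  (forall n x, `|u n x| <= M) -> (forall x, u n x @[n --> \oo] --> f x) ->
  \int[mu]_x u n x @[n --> \oo] --> \int[mu]_x f x.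
Proof.
move=> mu_ mf uM uf.
have [||||| fi _ cv] := @dominated_convergence _ (borel X) R mu setT measurableT
    (fun n => EFin \o u n) (EFin \o f) (EFin \o cst M).
- by move=> n; exact/measurable_realfun.measurable_EFinP.
- exact/measurable_realfun.measurable_EFinP.
- by apply: aeW => x _; apply: cvg_EFin (uf x); exact: nearW.
- exact: finite_measure_integrable_cst.
- by apply: aeW => x n _ /=; rewrite lee_fin.
apply: fine_cvg; rewrite fineK//; exact: integrable_fin_num.
Qed.

(** Open sets are stable under intersection and generate the Borel sets, so they suffice. The
    indicator of an open set [{phi > 0}] is the pointwise limit of the continuous functions
    [min 1 (n phi)], which lie between 0 and 1. *)
Lemma probability_eq_Rintegral mu nu :
  (forall f, continuous f ->
    \int[mu]_(x in [set: borel X]) f x = \int[nu]_(x in [set: borel X]) f x) ->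
  forall A : set (borel X), measurable A -> mu A = nu A.
Proof.
move=> munu A mA.
apply: (@g_sigma_algebra_measure_unique _ R (borel X) (@open X) _ (fun=> setT)) => //.
- by move=> U; exact: open_measurable_borel.
- by move=> _; exact: openT.
- by rewrite bigcup_const.
- by move=> U V; exact: openI.
- move=> U oU; have mU := open_measurable_borel oU.
  have [phi [cphi phi0 UE]] := open_cozero oU.
  pose p n x := Num.min 1 (n%:R * phi x).
  have cp n : continuous (p n).
    move=> x; apply: (@continuous_min _ _ (fun=> 1) (fun x => n%:R * phi x)).
      exact: cvg_cst.
    by apply: cvgM; [exact: cvg_cst|exact: cphi].
  have p0 n x : 0 <= p n x by rewrite le_min ler01 mulr_ge0.
  have p1 n x : `|p n x| <= 1 by rewrite ger0_norm// ge_min lexx.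
  have pU x : p n x @[n --> \oo] --> (\1_U x : R).
    rewrite indicE; have [|] := boolP (x \in U); rewrite ?inE ?notin_setE UE/=.
      move=> phix; apply: cvg_near_cst; near=> n; apply/min_idPl.
      rewrite -ler_pdivrMr// mul1r; apply: (@le_trans _ _ (Num.Def.trunc (phi x)^-1).+1%:R).
        by apply/ltW; exact: truncnS_gt.
      by rewrite ler_nat; near: n; exact: nbhs_infty_ge.
    move=> /negP; rewrite -leNgt => phix; apply: cvg_near_cst; apply: nearW => n.
    have phix0 : phi x = 0 by apply/eqP; rewrite eq_le phi0 phix.
    by rewrite /p phix0 mulr0 (min_idPr ler01).
  have cv (m : probability (borel X) R) :
      \int[m]_x p n x @[n --> \oo] --> fine (m U).
    have -> : fine (m U) = \int[m]_x \1_U x.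
      by rewrite /Rintegral integral_indic// setIT.
    apply: (bounded_convergence_Rintegral (M := 1)) => //.
    by move=> n; exact: continuous_measurable_borel.
  have : fine (mu U) = fine (nu U).
    have e : (fun n => \int[mu]_(x in [set: borel X]) p n x) =
             (fun n => \int[nu]_(x in [set: borel X]) p n x).
      by apply/funext => n; exact: munu.
    by have := cv mu; rewrite e => /(cvg_unique _ (cv nu))->.
  move=> h; have : mu U = nu U.
    by rewrite -(fineK (fin_num_measure mu _ mU)) h fineK ?fin_num_measure.
  exact.
- by move=> _; rewrite [ltLHS]probability_setT ltry.
Unshelve. all: by end_near. Qed.

Lemma eq_measure_Rintegral mu nu f :
  (forall A : set (borel X), measurable A -> mu A = nu A) ->
  \int[mu]_(x in [set: borel X]) f x = \int[nu]_(x in [set: borel X]) f x.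
Proof.
by move=> munu; congr fine; apply: eq_measure_integral => A mA _; exact: munu.
Qed.

(** Invariance says that the image measure [distribution nu Y] agrees with [nu] on Borel sets; by
    change of variables, the right-hand side says that both have the same integrals of continuous
    functions. *)
Lemma invariant_measureP (T : X -> X) nu : continuous T ->
  invariant_measure T nu <->
  forall f, continuous f ->
    \int[nu]_(x in [set: borel X]) f (T x) = \int[nu]_(x in [set: borel X]) f x.
Proof.
move=> cT; have mT := continuous_borel_measurable cT.
pose Y : {mfun borel X >-> borel X} :=
  HB.pack (T : borel X -> borel X) (isMeasurableFun.Build _ _ _ _ _ mT).
have YE f : continuous f ->
    \int[distribution nu Y]_(x in [set: borel X]) f x = \int[nu]_(x in [set: borel X]) f (T x).
  move=> cf; congr fine; apply: integral_distribution.
    by apply/measurable_realfun.measurable_EFinP; exact: continuous_measurable_borel.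
  apply: (continuous_integrable X_compact nu measurableT (f := f \o T)).
  by move=> x; apply: continuous_comp (cT x) (cf _).
split => [iT f cf|iT A mA].
  by rewrite -YE//; exact: eq_measure_Rintegral.
apply: (probability_eq_Rintegral (mu := distribution nu Y)) => // f cf.
by rewrite YE// iT.
Qed.

End determination.

(** * Time averages and invariant functionals *)

Section ultra.
Context {T : Type} {R : realType}.
Implicit Types u : T -> R.

Lemma cvg_ultra (F : set_system T) u (l : R) : ProperFilter F ->
  (forall G, UltraFilter G -> F `<=` G -> u @ G --> l) -> u @ F --> l.
Proof.
move=> FF ul A lA; apply: contrapT => FA.
pose H := within (~` (u @^-1` A)) F.
have HF : Filter H by exact: within_filter.
have HP : ProperFilter H.
  apply: Build_ProperFilter => //; rewrite /H /within /= => F0; apply: FA.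
  by apply: filterS F0 => x /= nA; apply: contrapT => /nA.
have [G [GU HG]] := ultraFilterLemma HP.
have FG : F `<=` G by move=> B FB; apply: HG; apply: filterS FB => x Bx _.
have GA : G (u @^-1` A) by exact: (ul G GU FG A lA).
have GnA : G (~` (u @^-1` A)).
  by apply: HG; exact: withinT.
by have [x [Ax nAx]] := filter_ex (filterI GA GnA); exact: nAx.
Qed.

(** The image of [G] clusters at a point of the compact interval [[-M, M]], and an ultrafilter
    converges to each of its cluster points. *)
Lemma bounded_ultra_cvg (G : set_system T) u M : UltraFilter G ->
  (\forall t \near G, `|u t| <= M) -> cvg (u @ G).
Proof.
move=> GU uM; have Gc : (u @ G) (`[- M, M]%classic : set R).
  by apply: filterS uM => t /=; rewrite in_itv/= ler_norml.
have [p [_ cp]] := @segment_compact R (- M) M (u @ G) _ Gc.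
apply/cvg_ex; exists p => A pA.
have [//|GnA] := in_ultra_setVsetC (u @^-1` A) GU.
by have [y [nAy Ay]] := cp (~` A) A GnA pA; exfalso; exact: nAy.
Qed.

End ultra.

(** * Time averages of real functions *)

Section time_average.
Context {R : realType} {X : topologicalType}.
Variable T : X -> X.
Hypothesis cT : continuous T.

(** The real counterpart of [ergodic_average], for real and imaginary parts. Its value at [k = 0] is
    0. *)
Definition time_average (f : X -> R) (k : nat) (x : X) : R :=
  k%:R^-1 * \sum_(i < k) f (iter i T x).

Lemma continuous_iter i : continuous (iter i T).
Proof.
elim: i => [|i IHi] x; first exact: cvg_id.
have -> : iter i.+1 T = T \o iter i T by [].
by apply: continuous_comp; [exact: IHi|exact: cT].
Qed.

Lemma continuous_time_average (f : X -> R) k : continuous f -> continuous (time_average f k).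
Proof.
move=> cf x; apply: cvgM; first exact: cvg_cst.
apply: (continuous_sum_ord (g := fun i y => f (iter i T y))) => i y.
by apply: (@continuous_comp _ _ _ (iter i T) f); [exact: continuous_iter|exact: cf].
Qed.

Lemma time_average_shift (f : X -> R) k x :
  time_average (f \o T) k x = time_average f k x + k%:R^-1 * (f (iter k T x) - f x).
Proof.
rewrite /time_average -mulrDr; congr (_ * _).
have := @big_ord_recl R 0 +%R k (fun i => f (iter i T x)).
by rewrite big_ord_recr/= addrA => ->; rewrite [f x + _]addrC addrK.
Qed.

Lemma positive_functional_time_average (L : (X -> R) -> R) k : (0 < k)%N ->
  positive_functional L -> positive_functional (fun f => L (time_average f k)).
Proof.
move=> k0 pL; have ca := fun f : X -> R => @continuous_time_average f k.
split => [f g cf cg|c f cf|f cf f0|].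
- rewrite -(functionalD pL); [|exact: ca|exact: ca]; congr L; apply/funext => x.
  by rewrite /time_average big_split mulrDr.
- rewrite -(functionalZ pL); last exact: ca; congr L; apply/funext => x.
  by rewrite /time_average -mulr_sumr mulrCA.
- apply: (functional_ge0 pL); first exact: ca.
  by move=> x; rewrite mulr_ge0 ?invr_ge0// sumr_ge0.
- rewrite -[RHS](functional1 pL); congr L; apply/funext => x.
  by rewrite /time_average sumr_const card_ord mulVf// pnatr_eq0 -lt0n.
Qed.

End time_average.

(** * Convergence of averages under unique ergodicity *)

Section mean_time_average.
Context {R : realType} {X : pmetricType R}.
Hypothesis X_compact : compact [set: X].
Variables (T : X -> X) (mu : probability (borel X) R).
Hypothesis cT : continuous T.
Hypothesis mu_unique : forall nu : probability (borel X) R, invariant_measure T nu ->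
  forall A : set (borel X), measurable A -> nu A = mu A.

(** Any limit of [p k (time_average T f k)] along an ultrafilter is an invariant positive functional
    of [f], hence integration against [mu]. Since all these limits coincide, the sequence converges.
    Means over sets [F k] are one choice of [p k]. *)
Lemma uniquely_ergodic_functional_cvg (p : nat -> (X -> R) -> R) (f : X -> R) :
  (forall k, (0 < k)%N -> positive_functional (p k)) -> continuous f ->
  p k (time_average T f k) @[k --> \oo] --> \int[mu]_(x in [set: borel X]) f x.
Proof.
move=> pp cf; pose a (g : X -> R) k := p k (time_average T g k).
have ca g k : continuous g -> continuous (time_average T g k).
  exact: continuous_time_average.
apply: cvg_ultra => G GU ooG; pose L g := lim (a g k @[k --> G]).
have k0 : \forall k \near G, (0 < k)%N by apply: ooG; exists 1%N.
have pa k : (0 < k)%N -> positive_functional (fun g => a g k).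
  by move=> kgt0; apply: positive_functional_time_average => //; exact: pp.
have aL g : continuous g -> a g k @[k --> G] --> L g.
  move=> cg; have [M M0 gM] := continuous_compact_bounded X_compact cg.
  apply: (bounded_ultra_cvg (M := M)); apply: filterS k0 => k kgt0.
  exact: (functional_norm_le (pa k kgt0) cg gM).
(* Identities for [a g k] with [k > 0] pass to the limit [L]; [k = 0] is negligible for [G]. *)
have aL_eq g c (b : nat -> R) : continuous g -> b k @[k --> G] --> c ->
    (forall k, (0 < k)%N -> a g k = b k) -> L g = c.
  move=> cg bc ab; apply: (cvg_unique _ (aL g cg)) => //.
  apply: cvg_trans bc; apply: near_eq_cvg; apply: filterS k0 => k kgt0.
  by rewrite ab.
have pL : positive_functional L.
  split => [g h cg ch|c g cg|g cg g0|].
  - apply: (aL_eq _ _ (fun k => a g k + a h k)).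
    + by move=> x; exact: cvgD (cg x) (ch x).
    + by apply: cvgD; exact: aL.
    + by move=> k /pa pak; rewrite (functionalD pak).
  - apply: (aL_eq _ _ (fun k => c * a g k)).
    + by move=> x; apply: cvgM; [exact: cvg_cst|exact: cg].
    + by apply: cvgM; [exact: cvg_cst|exact: aL].
    + by move=> k /pa pak; rewrite (functionalZ pak).
  - apply: (limr_ge (cvgP _ (aL g cg))); apply: filterS k0 => k /pa pak.
    exact: (functional_ge0 pak).
  - apply: (aL_eq _ _ (fun=> 1)); [by move=> x; exact: cvg_cst|exact: cvg_cst|].
    by move=> k /pa pak; rewrite (functional1 pak).
have LT g : continuous g -> L (g \o T) = L g.
  move=> cg; have [M M0 gM] := continuous_compact_bounded X_compact cg.
  have cgT : continuous (g \o T).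
    by move=> x; apply: (@continuous_comp _ _ _ T g); [exact: cT|exact: cg].
  (* By telescoping, the difference is [p k] of a function bounded by [2 * M / k]. It tends to 0 at
     infinity, hence along the finer filter [G]. *)
  apply: (aL_eq _ _ (fun k => a g k + (a (g \o T) k - a g k))) => //; last first.
    by move=> k _; rewrite subrKC.
  rewrite -[X in _ --> X]addr0; apply: cvgD; first exact: aL.
  have d0 : (2 * M) * k%:R^-1 @[k --> \oo] --> (0 : R).
    rewrite -[X in _ --> X](mulr0 (2 * M)); apply: cvgM; first exact: cvg_cst.
    by rewrite -cvg_shiftS; exact: cvg_harmonic.
  suff : a (g \o T) k - a g k @[k --> \oo] --> (0 : R) by move=> h A /h; exact: ooG.
  apply/norm_cvg0P; apply: squeeze_cvgr (cvg_cst 0) d0.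
  near=> k; rewrite normr_ge0/=.
  have kgt0 : (0 < k)%N by near: k; exists 1%N.
  have pk := pp k kgt0.
  have cgk : continuous (fun x => k%:R^-1 * (g (iter k T x) - g x)).
    move=> x; apply: cvgM; first exact: cvg_cst.
    apply: cvgB; last exact: cg.
    by apply: (@continuous_comp _ _ _ (iter k T) g); [exact: continuous_iter|exact: cg].
  have -> : a (g \o T) k - a g k = p k (fun x => k%:R^-1 * (g (iter k T x) - g x)).
    rewrite /a (_ : time_average T (g \o T) k = fun x => time_average T g k x +
      k%:R^-1 * (g (iter k T x) - g x)); last first.
      by apply/funext => x; exact: time_average_shift.
    by rewrite (functionalD pk)//; [rewrite addrC addKr|exact: ca].
  apply: (functional_norm_le pk cgk) => x.
  rewrite normrM ger0_norm ?invr_ge0// mulrC ler_wpM2r ?invr_ge0//.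
  by rewrite (le_trans (ler_normB _ _))// mulr_natl mulr2n lerD.
have [nu nuL] := riesz_representation X_compact pL.
have nuT : invariant_measure T nu.
  apply/(invariant_measureP X_compact nu cT) => g cg.
  have cgT : continuous (g \o T).
    by move=> x; apply: (@continuous_comp _ _ _ T g); [exact: cT|exact: cg].
  by rewrite (nuL g cg) -(LT g cg) -(nuL _ cgT).
rewrite -(eq_measure_Rintegral f (mu_unique nuT)) nuL//; exact: aL.
Unshelve. all: by end_near. Qed.

End mean_time_average.

(** * Complex-valued averages *)

Section complex_convergence.
Context {R : realType}.
Local Open Scope complex_scope.

Lemma normc_ge_Im (z : R[i]) : `|complex.Im z|%:C <= `|z|.
Proof.
rewrite normc_def lecR -sqrtr_sqr ler_wsqrtr// lerDr sqr_ge0//.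
Qed.

Lemma cvg_complexP {T : Type} (F : set_system T) (u : T -> R[i]) (l : R[i]) :
  Filter F ->
  u @ F --> l <-> complex.Re (u t) @[t --> F] --> complex.Re l /\
                  complex.Im (u t) @[t --> F] --> complex.Im l.
Proof.
move=> FF; split=> [/(@cvgrPdist_lt _ R[i]^o) ul|].
  split; apply/cvgrPdist_lt => e e0.
    have e0' : 0 < e%:C by rewrite ltcR.
    apply: filterS (ul _ e0') => t; rewrite -ltcR; apply: le_lt_trans.
    by rewrite -raddfB; exact: normc_ge_Re.
  have e0' : 0 < e%:C by rewrite ltcR.
  apply: filterS (ul _ e0') => t; rewrite -ltcR; apply: le_lt_trans.
  by rewrite -raddfB; exact: normc_ge_Im.
move=> [/cvgrPdist_lt ur /cvgrPdist_lt ui].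
apply/(@cvgrPdist_lt _ R[i]^o) => -[e e'].
(* A positive complex number is real, so the imaginary part of the radius vanishes. *)
rewrite ltcE/= => /andP[/eqP-> e0].
have e20 : 0 < e / 2 by rewrite divr_gt0.
apply: filterS2 (ur _ e20) (ui _ e20) => t rt it.
rewrite [l - u t]complexE (le_lt_trans (ler_normD _ _))//.
have nC (r : R) : `|r%:C| = `|r|%:C by rewrite normc_def/= expr0n addr0 sqrtr_sqr.
have ni : `|'i%C : R[i]| = 1 by rewrite normc_def/= expr0n add0r expr1n sqrtr1.
rewrite normrM ni mul1r !nC -rmorphD ltcR !raddfB/=.
by rewrite (splitr e) ltrD.
Qed.

End complex_convergence.

Section complex_averages.
Context {R : realType} {X : pmetricType R}.
Hypothesis X_compact : compact [set: X].
Variable mu : probability (borel X) R.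
Local Open Scope complex_scope.

Lemma ergodic_average_ReIm (T : X -> X) (f : X -> R[i]) k x :
  ergodic_average T f k x =
    time_average T (fun y => complex.Re (f y)) k x +i*
    time_average T (fun y => complex.Im (f y)) k x.
Proof.
rewrite /ergodic_average /time_average -(raddf_sum (@complex.Re R)).
rewrite -(raddf_sum (@complex.Im R)) /=.
have -> : k%:R^-1 = (k%:R^-1)%:C :> R[i] by rewrite fmorphV rmorph_nat.
by case: (\sum_(i < k) _) => a b /=; simpc.
Qed.

Lemma mean_ergodic_average (F : set (borel X)) (T : X -> X) (f : X -> R[i]) k :
  mean mu F (ergodic_average T f k) =
    ((fine (mu F))^-1 *
      \int[mu]_(x in F) time_average T (fun y => complex.Re (f y)) k x) +i*
    ((fine (mu F))^-1 *
      \int[mu]_(x in F) time_average T (fun y => complex.Im (f y)) k x).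
Proof.
rewrite /mean /Cintegral; under eq_Rintegral do rewrite ergodic_average_ReIm.
rewrite [X in _ +i* X](_ : _ =
    \int[mu]_(x in F) time_average T (fun y => complex.Im (f y)) k x).
  by simpc.
by apply: eq_Rintegral => x _; rewrite ergodic_average_ReIm.
Qed.

Lemma mean_norm_le (F : set (borel X)) (f : X -> R) M : measurable F -> (0 < mu F)%E ->
  continuous f -> (forall x, F x -> `|f x| <= M) ->
  `|(fine (mu F))^-1 * \int[mu]_(x in F) f x| <= M.
Proof.
move=> mF F0 cf fM; have muF0 : 0 < fine (mu F).
  by rewrite fine_gt0// F0 -ge0_fin_numE ?fin_num_measure.
have nf : continuous (fun x => `|f x|).
  by move=> x; apply: continuous_comp (cf x) _; exact: norm_continuous.
rewrite normrM gtr0_norm ?invr_gt0// mulrC ler_pdivrMr//.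
apply: (@le_trans _ _ (\int[mu]_(x in F) `|f x|)).
  by apply: (@le_normr_Rintegral _ (borel X)) => //; exact: continuous_integrable.
rewrite -(@Rintegral_cst _ (borel X))//.
apply: (@le_Rintegral _ (borel X)) => //; first exact: continuous_integrable.
by apply: continuous_integrable => // x; exact: cvg_cst.
Qed.

End complex_averages.

(** * From means over open sets to pointwise convergence *)

Section uniquely_ergodic_of_open_means.
Context {R : realType} {X : pmetricType R}.
Hypothesis X_compact : compact [set: X].
Variables (T : X -> X) (mu : probability (borel X) R).
Hypothesis cT : continuous T.

Lemma invariant_Rintegral_time_average (nu : probability (borel X) R) (f : X -> R) k :
  invariant_measure T nu -> continuous f -> (0 < k)%N ->
  \int[nu]_(x in [set: borel X]) time_average T f k x =
  \int[nu]_(x in [set: borel X]) f x.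
Proof.
move=> /(invariant_measureP X_compact nu cT) iT cf k0.
have pI := positive_functional_Rintegral X_compact nu.
have cfi i : continuous (fun x => f (iter i T x)).
  move=> x; apply: (@continuous_comp _ _ _ (iter i T) f); last exact: cf.
  exact: continuous_iter.
have fi i : \int[nu]_(x in [set: borel X]) f (iter i T x) =
            \int[nu]_(x in [set: borel X]) f x.
  elim: i => // i <-; rewrite -(iT _ (cfi i)).
  by apply: eq_Rintegral => x _; rewrite -iterSr.
rewrite (functionalZ pI); last exact: (continuous_sum_ord (g := fun i x => f (iter i T x))).
rewrite (functional_sum pI (g := fun i x => f (iter i T x)))//.
under eq_bigr do rewrite fi.
by rewrite sumr_const card_ord -[X in _ * X]mulr_natl mulKf// pnatr_eq0 -lt0n.
Qed.

(* The neighbourhood where [time_average T f k] varies by less than [1 / (k + 1)] turns the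
   convergence of means over open sets into pointwise convergence. *)
Lemma open_means_pointwise_cvg (f : X -> R) (x : X) :
  strictly_positive mu -> continuous f ->
  (forall U : nat -> set X,
    (forall k, (0 < k)%N -> open (U k) /\ (0 < mu (U k))%E) ->
    (fine (mu (U k)))^-1 * \int[mu]_(y in U k) time_average T f k y @[k --> \oo] -->
    \int[mu]_(y in [set: borel X]) f y) ->
  time_average T f k x @[k --> \oo] --> \int[mu]_(y in [set: borel X]) f y.
Proof.
move=> mu_gt0 cf Ucvg.
have ca k : continuous (time_average T f k) by exact: continuous_time_average.
pose d k y := time_average T f k y - time_average T f k x.
have cd k : continuous (d k).
  by move=> y; apply: cvgB; [exact: ca|exact: cvg_cst].
(* [harmonic k] is [1 / (k + 1)], positive even at [k = 0], so [U k] always contains [x]. *)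
pose U k := [set y | `|d k y| < harmonic k].
have oU k : open (U k).
  have /continuousP : continuous (fun y => `|d k y|).
    by move=> y; apply: continuous_comp (cd k y) _; exact: norm_continuous.
  by move=> /(_ _ (@open_lt _ (harmonic k))).
have Upos k : (0 < mu (U k))%E.
  by apply: mu_gt0 => //; exists x; rewrite /U /= /d subrr normr0 invr_gt0.
have dU : (fine (mu (U k)))^-1 * \int[mu]_(y in U k) d k y @[k --> \oo] --> (0 : R).
  apply/norm_cvg0P; apply: squeeze_cvgr (cvg_cst 0) cvg_harmonic.
  apply: nearW => k; rewrite normr_ge0/=; apply: mean_norm_le => //.
    exact: open_measurable_borel.
  by move=> y /ltW.
rewrite -[X in _ --> X]subr0.
(* The value at [x] is the mean over [U k] of the time average minus the mean of its deviation
   [d k], and the latter tends to 0. *)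
rewrite (_ : (fun k => _) = fun k =>
    (fine (mu (U k)))^-1 * \int[mu]_(y in U k) time_average T f k y -
    (fine (mu (U k)))^-1 * \int[mu]_(y in U k) d k y).
  by apply: cvgB => //; exact: Ucvg.
apply/funext => k.
have pm := positive_functional_mean X_compact (open_measurable_borel (oU k)) (Upos k).
have c1 : continuous ((fun=> 1) : X -> R) by move=> y; exact: cvg_cst.
have cx : continuous (fun y : X => time_average T f k x * 1) by move=> y; exact: cvg_cst.
rewrite [in RHS](_ : time_average T f k = fun y => d k y + time_average T f k x * 1).
  rewrite (functionalD pm (cd k) cx) (functionalZ pm _ c1) (functional1 pm).
  by rewrite mulr1 addrC addKr.
by apply/funext => y; rewrite mulr1 subrK.
Qed.

End uniquely_ergodic_of_open_means.

Theorem theorem1p8 (R : realType) (X : pmetricType R) (T : X -> X)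
    (mu : probability (borel X) R)
    (X_compact : compact [set: X])
    (T_homeo : homeomorphism T)
    (mu_ergodic : ergodic T mu) :
  let cond1 := uniquely_ergodic T in
  let cond2 :=
    forall (F : nat -> set (borel X)) (f : X -> R[i]),
      (forall k, (0 < k)%N -> measurable (F k) /\ (0 < mu (F k))%E) ->
      continuous f ->
      mean mu (F k) (ergodic_average T f k) @[k --> \oo]
        --> Cintegral mu setT f in
  let cond3 :=
    forall (U : nat -> set X) (f : X -> R[i]),
      (forall k, (0 < k)%N -> open (U k) /\ (0 < mu (U k))%E) ->
      continuous f ->
      mean mu (U k) (ergodic_average T f k) @[k --> \oo]
        --> Cintegral mu setT f in
  [/\ cond1 -> cond2,
      cond2 -> cond3
    & strictly_positive mu -> cond3 -> cond1].
Proof.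
have [cT _] := T_homeo; have [mu_inv _] := mu_ergodic.
move=> cond1 cond2 cond3; split.
- move=> [mu' [_ mu'_unique]] F f F_pos cf.
  (* Being invariant, [mu] agrees on Borel sets with the unique invariant measure [mu']. *)
  have mu_unique (nu : probability (borel X) R) : invariant_measure T nu ->
      forall A : set (borel X), measurable A -> nu A = mu A.
    by move=> nu_inv A mA; rewrite (mu'_unique _ nu_inv)// (mu'_unique _ mu_inv).
  have cReIm x := (cvg_complexP f (f x) (nbhs_filter x)).1 (cf x).
  pose p k (g : X -> R) := (fine (mu (F k)))^-1 * \int[mu]_(x in F k) g x.
  have pp k : (0 < k)%N -> positive_functional (p k).
    by move=> /F_pos[mF F0]; exact: positive_functional_mean.
  rewrite (funext (fun k => mean_ergodic_average mu (F k) T f k)).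
  apply/cvg_complexP; split.
  + exact: (uniquely_ergodic_functional_cvg X_compact cT mu_unique pp (fun x => (cReIm x).1)).
  + exact: (uniquely_ergodic_functional_cvg X_compact cT mu_unique pp (fun x => (cReIm x).2)).
- move=> F_cvg U f U_pos cf; apply: F_cvg => // k /U_pos[oU U0]; split => //.
  exact: open_measurable_borel.
- move=> mu_gt0 U_cvg; exists mu; split => // nu nu_inv.
  apply: probability_eq_Rintegral => f cf.
  have pw x : time_average T f k x @[k --> \oo] --> \int[mu]_(y in [set: borel X]) f y.
    apply: open_means_pointwise_cvg => // U U_pos.
    (* Condition (3) is applied to [f] seen as a complex function, and the real part is kept. *)
    have cfC : continuous (fun x => (f x)%:C%C).
      by move=> y; apply/cvg_complexP; split; [exact: cf|exact: cvg_cst].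
    have := U_cvg U _ U_pos cfC.
    rewrite (funext (fun k => mean_ergodic_average mu (U k) T _ k)).
    by move=> /cvg_complexP[].
  have [M M0 fM] := continuous_compact_bounded X_compact cf.
  have aM k x : `|time_average T f k x| <= M.
    rewrite normrM ger0_norm ?invr_ge0//.
    have [->|k0] := posnP k; first by rewrite invr0 mul0r.
    rewrite mulrC ler_pdivrMr ?ltr0n// (le_trans (ler_norm_sum _ _ _))//.
    apply: (@le_trans _ _ (\sum_(i < k) M)); first exact: ler_sum.
    by rewrite sumr_const card_ord mulr_natr.
  (* The pointwise limit is a constant, equal to its own integral against the probability [nu]. *)
  have cv : \int[nu]_(x in [set: borel X]) time_average T f k x @[k --> \oo] -->
      \int[mu]_(x in [set: borel X]) f x.
    have -> : \int[mu]_(x in [set: borel X]) f x =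
        \int[nu]_(_ in [set: borel X]) \int[mu]_(x in [set: borel X]) f x.
      rewrite (@Rintegral_cst _ (borel X))//.
      by rewrite [fine _](congr1 fine (probability_setT nu)) mulr1.
    apply: (bounded_convergence_Rintegral (M := M)) => // k.
    by apply: continuous_measurable_borel; exact: continuous_time_average.
  apply: (cvg_unique _ _ cv) => //.
  (* By invariance of [nu] the same sequence of integrals is constant for [k > 0], so its two limits
     agree. *)
  apply: cvg_near_cst; near=> k; apply: invariant_Rintegral_time_average => //.
  by near: k; exists 1%N.
Unshelve. all: by end_near. Qed.
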